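(* Let $\mu$ be a probability measure on $\mathbb{R}^d$ that is absolutely continuous with respect to Lebesgue measure and let $t>0$. For $s\ge 0$ let $\Pi_s$ denote the convex hull of the points of a Poisson point process on $\mathbb{R}^d$ with intensity measure $s\mu$, let $N(\Pi_s)$ be the number of vertices of $\Pi_s$, and let $\Delta(\Pi_s)=\mu(\mathbb{R}^d\setminus\Pi_s)$. Then for every $x\in[0,1]$, $$g_{N(\Pi_t)}(x)=h_{\Delta(\Pi_{xt})}(t(x-1)),$$ where $g_X(z)=\mathbb{E}\, z^X$ is the generating function and $h_X(z)=\mathbb{E}\, e^{zX}$ the moment generating function of a random variable $X$.
   Context: A Poisson point process with intensity measure $s\mu$ is a random finite simple counting measure $\eta$ such that $\eta(A)$ is Poisson distributed with parameter $s\mu(A)$ for every Borel set $A$ and counts of pairwise disjoint Borel sets are independent. The convex hull of the empty set is empty. *)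

(* Defs.v *)
From HB Require Import structures.
From mathcomp Require Import all_boot all_order all_algebra finmap.
From mathcomp Require Import all_classical all_reals all_analysis.

Set Implicit Arguments.
Unset Strict Implicit.
Unset Printing Implicit Defensive.

Import Order.TTheory GRing.Theory Num.Theory.

Local Open Scope classical_set_scope.
Local Open Scope ring_scope.


(* Points of R^d are d-tuples of reals; d.-tuple R carries the product
   (= Borel) sigma-algebra of MathComp-Analysis. *)

Definition box {R : realType} (d : nat) (a b : d.-tuple R) : set (d.-tuple R) :=
  [set x | forall i : 'I_d, tnth a i <= tnth x i <= tnth b i].

Definition box_volume {R : realType} (d : nat) (a b : d.-tuple R) : R :=
  \prod_(i < d) (tnth b i - tnth a i).

Definition lebesgue_null {R : realType} (d : nat) (A : set (d.-tuple R)) : Prop :=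
  forall eps : R, 0 < eps ->
    exists a b : nat -> d.-tuple R,
      [/\ (forall n (i : 'I_d), tnth (a n) i <= tnth (b n) i),
          A `<=` \bigcup_n box (a n) (b n) &
          (\sum_(n <oo) (box_volume (a n) (b n))%:E <= eps%:E)%E].

Definition abs_cont_lebesgue {R : realType} (d : nat)
    (mu : set (d.-tuple R) -> \bar R) : Prop :=
  forall A : set (d.-tuple R), measurable A -> lebesgue_null A -> mu A = 0%E.

Definition conv_hull {R : realType} (d : nat) (S : {fset d.-tuple R})
    : set (d.-tuple R) :=
  [set x | exists w : d.-tuple R -> R,
     [/\ (forall p, p \in S -> 0 <= w p),
         \sum_(p <- S) w p = 1 &
         forall i : 'I_d, tnth x i = \sum_(p <- S) w p * tnth p i]].

Definition extreme_point {R : realType} (d : nat) (C : set (d.-tuple R))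
    (x : d.-tuple R) : Prop :=
  C x /\
  forall (y z : d.-tuple R) (l : R), C y -> C z -> 0 < l < 1 ->
    (forall i : 'I_d, tnth x i = l * tnth y i + (1 - l) * tnth z i) -> y = z.

(* number of vertices of conv(S); every vertex of conv(S) is a point of S *)
Definition num_vertices {R : realType} (d : nat) (S : {fset d.-tuple R}) : nat :=
  #|` [fset p in S | `[< extreme_point (conv_hull S) p >]]%fset |%fset.

Definition count_in {R : realType} (d : nat) (S : {fset d.-tuple R})
    (A : set (d.-tuple R)) : nat :=
  #|` [fset p in S | `[< A p >]]%fset |%fset.

(* Poisson(lambda) probability mass function, lambda >= 0
   (Poisson(0) is the Dirac mass at 0) *)
Definition poisson_mass {R : realType} (lambda : R) (k : nat) : R :=
  expR (- lambda) * lambda ^+ k / k`!%:R.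

(* eta is a Poisson point process on R^d with intensity measure s * mu,
   defined on the probability space (Omega, P): a random finite simple
   counting measure (represented by its finite support eta w) such that
   - every count eta(A), A Borel, is a random variable,
   - eta(A) is Poisson distributed with parameter s * mu(A),
   - counts of finitely many pairwise disjoint Borel sets are independent. *)
Definition poisson_point_process {R : realType} (d : nat)
    {dO : measure_display} {Omega : measurableType dO}
    (P : probability Omega R) (mu : set (d.-tuple R) -> \bar R) (s : R)
    (eta : Omega -> {fset d.-tuple R}) : Prop :=
  [/\ (forall A : set (d.-tuple R), measurable A -> forall k : nat,
         measurable [set w | count_in (eta w) A = k]),
      (forall A : set (d.-tuple R), measurable A -> forall k : nat,
         P [set w | count_in (eta w) A = k]
           = (poisson_mass (s * fine (mu A)) k)%:E) &
      (forall (m : nat) (A : 'I_m -> set (d.-tuple R)),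
         (forall i, measurable (A i)) ->
         (forall i j, i != j -> A i `&` A j = set0) ->
         forall B : 'I_m -> set nat,
           P (\bigcap_(i in [set: 'I_m]) [set w | B i (count_in (eta w) (A i))])
           = (\prod_(i < m) P [set w | B i (count_in (eta w) (A i))])%E)].

(* Main.v *)
(* Colour each point of the process of intensity t mu independently, with
   probability x for the first colour, and let I and J be the two colour
   classes. Given the points S = I + J, the inclusion J <= conv I holds iff J
   contains no vertex of conv S, which has probability x^N(S); so E x^N is the
   probability that J <= conv I. On the other hand I and J are independent
   Poisson processes of intensities x t mu and (1 - x) t mu, so given I the
   same event has probability exp (- (1 - x) t mu (~ conv I)).
   The independence of I and J is only needed for void probabilities: the
   complement of conv I is the union of the members of a fixed countable family
   of half-spaces that miss I, and for finitely many of them the indicator of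
   "J misses every half-space that I misses" is, by inclusion-exclusion, an
   integer combination of indicators of "I misses A and J misses B". *)

Require Import Defs.
From HB Require Import structures.
From mathcomp Require Import all_boot all_order all_algebra finmap.
From mathcomp Require Import all_classical all_reals all_analysis.
From mathcomp Require Import measurable_realfun ring lra.

Import Order.TTheory GRing.Theory Num.Theory.
Import numFieldNormedType.Exports.
Local Open Scope classical_set_scope.
Local Open Scope ring_scope.

(** * Farkas' lemma *)

Definition dot {R : realType} {n : nat} (u v : 'I_n -> R) : R :=
  \sum_i u i * v i.

Lemma dot_subl {R : realType} {n : nat} (k : R) (u u' v : 'I_n -> R) :
  dot (fun i => u i - k * u' i) v = dot u v - k * dot u' v.
Proof.
rewrite /dot mulr_sumr -sumrB; apply: eq_bigr => i _; ring.
Qed.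

Lemma dot_subr {R : realType} {n : nat} (k : R) (u v v' : 'I_n -> R) :
  dot u (fun i => v i - k * v' i) = dot u v - k * dot u v'.
Proof.
rewrite /dot mulr_sumr -sumrB; apply: eq_bigr => i _; ring.
Qed.

(* By induction on the list: when the separating vector u for the tail fails
   on the head v a, the problem is projected along v a onto the hyperplane
   orthogonal to u. *)
Lemma farkas {R : realType} {n : nat} {T : eqType} (s : seq T)
    (v : T -> 'I_n -> R) (b : 'I_n -> R) : uniq s ->
  (exists w : T -> R, (forall q, q \in s -> 0 <= w q) /\
     forall i, b i = \sum_(q <- s) w q * v q i) \/
  (exists u, (forall q, q \in s -> dot u (v q) <= 0) /\ 0 < dot u b).
Proof.
elim: s v b => [|a s IH] v b /=.
  move=> _; have [b0|/existsNP[i bi]] := pselect (forall i, b i = 0).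
    by left; exists (fun=> 0); split => // i; rewrite big_nil.
  right; exists b; split => //; rewrite /dot (bigD1 i) //= ltr_pwDl //.
    by rewrite -expr2 exprn_even_gt0 //=; apply/eqP.
  by rewrite sumr_ge0 // => j _; rewrite -expr2 sqr_ge0.
move=> /andP[aNs us].
have neqa q : q \in s -> (q == a) = false.
  by move=> qs; apply/negbTE; apply: contraNneq aNs => <-.
have [[w [w0 wb]]|[u [us0 ub]]] := IH v b us.
  left; exists (fun q => if q == a then 0 else w q); split => [q|i].
    by rewrite in_cons; case: eqP => //= _; exact: w0.
  rewrite big_cons eqxx mul0r add0r wb; apply: eq_big_seq => q qs.
  by rewrite neqa.
have [ua|ua] := leP (dot u (v a)) 0.
  right; exists u; split => // q; rewrite in_cons => /predU1P[->//|]; exact: us0.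
pose v' q i := v q i - dot u (v q) / dot u (v a) * v a i.
pose b' i := b i - dot u b / dot u (v a) * v a i.
have [[w [w0 wb]]|[u' [us0' ub']]] := IH v' b' us.
  (* Undoing the projections leaves the multiple [c] of [v a]. It is nonnegative because [dot u] is
     positive on [b] and [v a] and nonpositive on the tail. *)
  left; pose c := dot u b / dot u (v a)
     - \sum_(q <- s) w q * (dot u (v q) / dot u (v a)).
  exists (fun q => if q == a then c else w q); split => [q|i].
    rewrite in_cons; case: eqP => /= [_ _|_]; last exact: w0.
    rewrite subr_ge0 (@le_trans _ _ 0) //; last by rewrite divr_ge0 // ltW.
    rewrite big_seq sumr_le0 // => p ps; rewrite mulr_ge0_le0 ?w0 //.
    by rewrite mulr_le0_ge0 ?us0 // invr_ge0 ltW.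
  rewrite big_cons eqxx.
  under eq_big_seq => q qs do rewrite neqa //.
  have := wb i; rewrite /b' => /(canRL (subrK _)) ->.
  rewrite /v' /c mulrBl addrC -addrA; congr (_ + _).
  rewrite mulr_suml addrC -sumrN -big_split /=; apply: eq_bigr => q _; ring.
(* This is [u'] composed with the projection along [v a]: it vanishes on [v a] and takes on [v q]
   and [b] the values of [u'] on [v' q] and [b']. *)
right; exists (fun i => u' i - dot u' (v a) / dot u (v a) * u i).
have ua0 : dot u (v a) != 0 by rewrite gt_eqF.
split => [q|]; rewrite dot_subl.
  rewrite in_cons => /predU1P[->|qs]; first by rewrite divfK // subrr.
  have := us0' q qs; rewrite /v' dot_subr.
  by congr (_ <= _); field.
by move: ub'; rewrite /b' dot_subr; congr (_ < _); field.
Qed.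

(** * Homogeneous coordinates and separation by rational half-spaces *)

Definition homog {R : realType} {d : nat} (p : d.-tuple R) (i : 'I_d.+1) : R :=
  if unlift ord0 i is Some j then tnth p j else 1.

Lemma homog0 {R : realType} {d : nat} (p : d.-tuple R) : homog p ord0 = 1.
Proof. by rewrite /homog unlift_none. Qed.

Lemma homogS {R : realType} {d : nat} (p : d.-tuple R) (j : 'I_d) :
  homog p (lift ord0 j) = tnth p j.
Proof. by rewrite /homog liftK. Qed.

(** The extra coordinate 1 turns the condition that the weights sum to 1 into one more linear
    equation. Membership in a hull thus becomes membership in a finitely generated cone, the setting
    of [farkas]. *)
Lemma conv_hull_homog {R : realType} {d : nat} (S : {fset d.-tuple R})
    (p : d.-tuple R) :
  conv_hull S p <-> exists w : d.-tuple R -> R,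
    (forall q, q \in S -> 0 <= w q) /\
    forall i, homog p i = \sum_(q <- S) w q * homog q i.
Proof.
split=> [[w [w0 w1 wp]]|[w [w0 wp]]]; exists w.
  split => // i; have [j ->|->] := unliftP ord0 i.
    by rewrite homogS wp; apply: eq_bigr => q _; rewrite homogS.
  by rewrite homog0 -w1; apply: eq_bigr => q _; rewrite homog0 mulr1.
split => // [|j].
  by have := wp ord0; rewrite homog0 => ->; apply: eq_bigr => q _;
    rewrite homog0 mulr1.
have := wp (lift ord0 j); rewrite homogS => ->.
by apply: eq_bigr => q _; rewrite homogS.
Qed.

(** [u ord0] is the constant term and the other entries form the normal vector. A zero normal vector
    is allowed and gives the empty set or the whole space. *)
Definition half_space {R : realType} {d : nat} (u : 'I_d.+1 -> R)
    : set (d.-tuple R) := [set p | 0 < dot u (homog p)].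

Definition rat_half_space {R : realType} {d : nat} (u : {ffun 'I_d.+1 -> rat})
    : set (d.-tuple R) := half_space (fun i => ratr (u i)).

(** A linear functional that is nonpositive on the generators is nonpositive on their nonnegative
    combinations. *)
Lemma half_space_conv_hull {R : realType} {d : nat} (u : 'I_d.+1 -> R)
    (S : {fset d.-tuple R}) (p : d.-tuple R) :
  conv_hull S p -> half_space u p -> exists2 q, q \in S & half_space u q.
Proof.
move=> /conv_hull_homog[w [w0 wp]] up; apply: contrapT => nS.
move: up; rewrite /half_space /= ltNge => /negP; apply.
have -> : dot u (homog p) = \sum_(q <- S) w q * dot u (homog q).
  rewrite /dot; under eq_bigr do rewrite wp mulr_sumr.
  rewrite exchange_big /=; apply: eq_bigr => q _; rewrite mulr_sumr.
  by apply: eq_bigr => i _; rewrite mulrCA.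
rewrite big_seq sumr_le0 // => q qS; rewrite mulr_ge0_le0 ?w0 //.
by rewrite leNgt; apply/negP => uq; apply: nS; exists q.
Qed.

(** Farkas' lemma gives a real functional, nonpositive on [S] and positive at [p]. Once a strict
    margin is created on both sides, its coefficients can be rounded to rationals, which makes the
    separating family countable. *)
Lemma rat_half_space_separation {R : realType} {d : nat}
    (S : {fset d.-tuple R}) (p : d.-tuple R) : ~ conv_hull S p ->
  exists u : {ffun 'I_d.+1 -> rat}, rat_half_space u p /\
    forall q, q \in S -> ~ rat_half_space u q.
Proof.
move=> pS; have [|[u [uS up]]] := farkas S homog (homog p) (fset_uniq S).
  by move=> /conv_hull_homog.
(* Lowering the constant term by half the value at [p] leaves the value [e] at [p] and values at
   most [- e] on [S]. *)
pose e := dot u (homog p) / 2; have e0 : 0 < e by rewrite divr_gt0.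
pose u1 i := u i - e * (i == ord0)%:R.
have dot1 q : dot u1 (homog q) = dot u (homog q) - e.
  rewrite /u1 dot_subl; congr (_ - _); rewrite /dot (bigD1 ord0) //= homog0.
  by rewrite big1 ?addr0 ?mulr1 // => i /negbTE ->; rewrite mul0r.
pose M := \sum_(q <- p :: S) \sum_i `|homog q i|.
have M0 : 0 <= M by rewrite sumr_ge0 // => q _; rewrite sumr_ge0.
(* Coefficient errors below [D] change the value at [p] or at a point of [S] by at most [D * M],
   which is less than [e]. *)
pose D := e / (1 + M); have D0 : 0 < D by rewrite divr_gt0 // ltr_pwDl.
have ratD i : exists r : rat, `|ratr r - u1 i| < D.
  have [r] := @rat_in_itvoo R (u1 i - D) (u1 i + D) ltac:(lra).
  rewrite in_itv /= => /andP[r1 r2]; exists r.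
  rewrite ltr_norml; apply/andP; split; lra.
have [f fP] := choice ratD.
exists [ffun i => f i].
have approx q : q \in p :: (S : seq _) ->
    `|dot (fun i => ratr ([ffun i => f i] i)) (homog q) - dot u1 (homog q)| < e.
  move=> qpS; rewrite /dot -sumrB (le_lt_trans (ler_norm_sum _ _ _)) //.
  apply: (@le_lt_trans _ _ (D * \sum_i `|homog q i|)).
    rewrite mulr_sumr; apply: ler_sum => i _.
    by rewrite ffunE -mulrBl normrM ler_wpM2r // ltW.
  have : \sum_i `|homog q i| <= M.
    rewrite /M (big_rem q) //= lerDl sumr_ge0 // => ? _; exact: sumr_ge0.
  move=> /(ler_wpM2l (ltW D0)) /le_lt_trans; apply.
  by rewrite /D mulrAC ltr_pdivrMr ?ltr_pwDl // ltr_pM2l // ltrDr.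
split=> [|q qS].
  have := approx p (mem_head _ _); rewrite dot1 ltr_norml => /andP[+ _].
  by rewrite /rat_half_space /half_space /= /e; lra.
have := approx q; rewrite in_cons qS orbT => /(_ isT).
rewrite dot1 ltr_norml => /andP[_]; have := uS q qS.
rewrite /rat_half_space /half_space /= => uq h; apply/negP; rewrite -leNgt.
by move: uq h; lra.
Qed.

(** An index that codes no rational vector gives [set0], which every set of points misses and which
    adds nothing to a union. *)
Definition half_space_enum {R : realType} {d : nat} (n : nat)
    : set (d.-tuple R) :=
  if @choice.unpickle {ffun 'I_d.+1 -> rat} n is Some u then rat_half_space u else set0.

(* The complement of a convex hull is a union of members of one fixed countable
   family of half-spaces. *)
Lemma setC_conv_hull {R : realType} {d : nat} (S : {fset d.-tuple R}) :
  ~` conv_hull S = \bigcup_(n in [set n | forall q, q \in S ->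
                                   ~ half_space_enum n q]) half_space_enum n.
Proof.
apply/seteqP; split => [p|p [n /= nS np] pS].
  move=> /rat_half_space_separation[u [up uS]].
  by exists (@choice.pickle _ u); rewrite /half_space_enum /= choice.pickleK.
move: np nS; rewrite /half_space_enum; case: choice.unpickle => [u|//] up nS.
by have [q /nS] := half_space_conv_hull _ _ _ pS up.
Qed.

Lemma measurable_half_space {R : realType} {d : nat} (u : 'I_d.+1 -> R) :
  measurable (half_space u).
Proof.
have mh i : measurable_fun setT (fun p : d.-tuple R => homog p i).
  have [j ->|->] := unliftP ord0 i.
    by under eq_fun do rewrite homogS; exact: measurable_tnth.
  by under eq_fun do rewrite homog0; exact: measurable_cst.
have mdot : measurable_fun setT (fun p : d.-tuple R => dot u (homog p)).
  by apply: measurable_sum => i; apply: measurable_funM => //.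
have := mdot measurableT `]0, +oo[%classic (measurable_itv _).
rewrite setTI; congr measurable; apply/seteqP; split => p /=;
  by rewrite in_itv /= andbT.
Qed.

Lemma measurable_half_space_enum {R : realType} {d : nat} (n : nat) :
  measurable (@half_space_enum R d n).
Proof.
rewrite /half_space_enum; case: choice.unpickle => [f|].
  exact: measurable_half_space.
exact: measurable0.
Qed.

(** * Convex hulls of finite sets and their extreme points *)

Lemma conv_hull_sub {R : realType} {d : nat} (S S' : {fset d.-tuple R}) :
  (forall p, p \in S' -> conv_hull S p) -> conv_hull S' `<=` conv_hull S.
Proof.
move=> S'S x [w [w0 w1 wx]].
have /choice[W WP] : forall p, exists v : d.-tuple R -> R, p \in S' ->
    [/\ (forall q, q \in S -> 0 <= v q), \sum_(q <- S) v q = 1 &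
        forall i, tnth p i = \sum_(q <- S) v q * tnth q i].
  move=> p; have [/S'S[v]|] := boolP (p \in S'); first by exists v.
  by exists (fun=> 0).
exists (fun q => \sum_(p <- S') w p * W p q); split => [q qS||i].
- rewrite big_seq sumr_ge0 // => p pS'; rewrite mulr_ge0 ?w0 //.
  by have [+ _ _] := WP _ pS'; exact.
- rewrite exchange_big -w1; apply: eq_big_seq => p pS' /=.
  by have [_ + _] := WP _ pS'; rewrite -mulr_sumr => ->; rewrite mulr1.
- rewrite wx; under [RHS]eq_bigr do rewrite mulr_suml.
  rewrite exchange_big; apply: eq_big_seq => p pS' /=.
  have [_ _ ->] := WP _ pS'; rewrite mulr_sumr.
  by apply: eq_bigr => q _; rewrite mulrA.
Qed.

Lemma mem_conv_hull {R : realType} {d : nat} (S : {fset d.-tuple R}) p :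
  p \in S -> conv_hull S p.
Proof.
move=> pS; exists (fun q => (q == p)%:R); split => [q _||i].
- by rewrite ler0n.
- rewrite (big_rem p) //= eqxx big_seq big1 ?addr0 // => q.
  by rewrite mem_rem_uniq ?fset_uniq // inE => /andP[/negbTE ->].
- rewrite (big_rem p) //= eqxx mul1r big_seq big1 ?addr0 // => q.
  by rewrite mem_rem_uniq ?fset_uniq // inE => /andP[/negbTE -> _]; rewrite mul0r.
Qed.

Lemma conv_hull_mono {R : realType} {d : nat} (S S' : {fset d.-tuple R}) :
  (S' `<=` S)%fset -> conv_hull S' `<=` conv_hull S.
Proof. by move=> /fsubsetP S'S; apply: conv_hull_sub => p /S'S /mem_conv_hull. Qed.

(** Solve the convex combination for [v]: the other weights, divided by their sum [1 - w v],
    represent [v] again. *)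
Lemma conv_hull_rem_renorm {R : realType} {d : nat} (S : {fset d.-tuple R})
    (v : d.-tuple R) (w : d.-tuple R -> R) : v \in S ->
  (forall p, p \in S -> 0 <= w p) -> \sum_(p <- S) w p = 1 ->
  (forall i, tnth v i = \sum_(p <- S) w p * tnth p i) -> w v != 1 ->
  conv_hull (S `\ v)%fset v.
Proof.
move=> vS w0 w1 wv v1.
have split (f : d.-tuple R -> R) :
    \sum_(p <- S) f p = f v + \sum_(p <- (S `\ v)%fset) f p.
  by rewrite (big_fsetD1 v).
have wvE : \sum_(p <- (S `\ v)%fset) w p = 1 - w v.
  by rewrite -w1 split addrC addKr.
have nz : 1 - w v != 0 by rewrite subr_eq0 eq_sym.
have ge0 : 0 <= 1 - w v.
  rewrite -wvE big_seq sumr_ge0 // => p.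
  by rewrite in_fsetD1 => /andP[_] /w0.
exists (fun p => w p / (1 - w v)); split => [p|  |i].
- by rewrite in_fsetD1 => /andP[_] /w0 ?; rewrite divr_ge0.
- by rewrite -mulr_suml wvE divff.
- under eq_bigr do rewrite mulrAC.
  rewrite -mulr_suml; apply: (mulIf nz); rewrite divfK //.
  by have := wv i; rewrite split => h; rewrite mulrBr mulr1 [X in X - _]h; ring.
Qed.

Lemma weight1_eq {R : realType} {d : nat} (S : {fset d.-tuple R})
    (v x : d.-tuple R) (w : d.-tuple R -> R) : v \in S ->
  (forall p, p \in S -> 0 <= w p) -> \sum_(p <- S) w p = 1 ->
  (forall i, tnth x i = \sum_(p <- S) w p * tnth p i) -> w v = 1 -> x = v.
Proof.
move=> vS w0 w1 wx wv1; apply: eq_from_tnth => i.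
rewrite wx (big_fsetD1 v) //= wv1 mul1r big_seq big1 ?addr0 // => p pS.
move: w1; rewrite (big_fsetD1 v) //= wv1 -[RHS]addr0 => /addrI.
rewrite big_seq => /eqP; rewrite psumr_eq0; last first.
  by move=> q; rewrite in_fsetD1 => /andP[_] /w0.
by move=> /allP /(_ p pS); rewrite pS => /eqP ->; rewrite mul0r.
Qed.

(** If [v] lies strictly between [y] and [z], mixing their weights represents [v]. The mixed weight
    at [v] must be 1, as otherwise renormalising would put [v] in the hull of the other points. Both
    weights at [v] are at most 1, so both equal 1 and [y = v = z]. *)
Lemma extreme_point_rem {R : realType} {d : nat} (S : {fset d.-tuple R}) v :
  v \in S -> ~ conv_hull (S `\ v)%fset v -> extreme_point (conv_hull S) v.
Proof.
move=> vS nv; split; first exact: mem_conv_hull.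
move=> y z l [wy [wy0 wy1 wyy]] [wz [wz0 wz1 wzz]] /andP[l0 l1] vyz.
have le1 (w : d.-tuple R -> R) : (forall p, p \in S -> 0 <= w p) -> \sum_(p <- S) w p = 1 ->
    w v <= 1.
  move=> w0 w1; rewrite -w1 (big_fsetD1 v) //= lerDl big_seq sumr_ge0 // => p.
  by rewrite in_fsetD1 => /andP[_] /w0.
pose w p := l * wy p + (1 - l) * wz p.
have wv1 : w v = 1.
  apply/eqP; apply: contrapT => /negP wv1; apply: nv.
  apply: (@conv_hull_rem_renorm _ _ _ _ w) => // [p pS||i].
  - by rewrite addr_ge0 // mulr_ge0 ?wy0 ?wz0 ?subr_ge0 // ltW.
  - by rewrite big_split -!mulr_sumr /= wy1 wz1; ring.
  - rewrite vyz wyy wzz !mulr_sumr -big_split /=; apply: eq_bigr => p _.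
    by rewrite /w; ring.
have yv := le1 _ wy0 wy1; have zv := le1 _ wz0 wz1.
have yv1 : wy v = 1 by move: wv1; rewrite /w; nra.
have zv1 : wz v = 1 by move: wv1; rewrite /w; nra.
by rewrite (@weight1_eq _ _ S v y wy) // (@weight1_eq _ _ S v z wz).
Qed.

Definition vertices {R : realType} {d : nat} (S : {fset d.-tuple R})
    : {fset d.-tuple R} :=
  [fset p in S | `[< extreme_point (conv_hull S) p >]]%fset.

(** The Minkowski theorem for finite sets, by induction on the cardinality: a point of [S] that is
    not extreme lies in the hull of the others, so deleting it changes neither the hull nor the
    vertices. *)
Lemma conv_hull_vertices {R : realType} {d : nat} (S : {fset d.-tuple R}) :
  conv_hull (vertices S) = conv_hull S.
Proof.
have [n Sn] := ubnP #|`S|%fset; elim: n S Sn => // n IH S Sn.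
have [all_ext|/existsNP[v /not_implyP[vS nv]]] :=
  pselect (forall p, p \in S -> extreme_point (conv_hull S) p).
  suff -> : vertices S = S by [].
  apply/fsetP => p; rewrite !inE /=; case: (boolP (p \in S)) => //= pS.
  by apply/asboolP; exact: all_ext.
have vSv : conv_hull (S `\ v)%fset v.
  by apply: contrapT => h; apply: nv; exact: extreme_point_rem.
have SvE : conv_hull (S `\ v)%fset = conv_hull S.
  apply/seteqP; split; first exact/conv_hull_mono/fsubD1set.
  apply: conv_hull_sub => p pS; have [->//|pv] := eqVneq p v.
  by apply: mem_conv_hull; rewrite in_fsetD1 pv.
rewrite -SvE -(IH (S `\ v)%fset); last first.
  by move: Sn; rewrite (cardfsD1 v S) vS.
congr conv_hull; apply/fsetP => p; rewrite !inE /= SvE.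
have [->|//] := eqVneq p v; rewrite vS /=.
by apply/asboolP.
Qed.

(** Suppose [v] is not in [I]. Some [q] in [I] has positive weight in a representation of [v], and
    [v] lies strictly between [q] and the renormalised rest [z]. Extremality forces [q = z], hence
    [v = q], a contradiction. *)
Lemma extreme_point_conv_hull {R : realType} {d : nat} (S I : {fset d.-tuple R})
    v : (I `<=` S)%fset -> extreme_point (conv_hull S) v -> conv_hull I v ->
  v \in I.
Proof.
move=> IS [vS ext] vI; apply: contrapT => /negP vNI.
have [w [w0 w1 wv]] := vI.
have [q [qI wq]] : exists q, q \in I /\ 0 < w q.
  apply: contrapT => h; move: w1; rewrite big_seq big1 => [/eqP|q qI].
    by rewrite eq_sym oner_eq0.
  apply/eqP; rewrite eq_le w0 // andbT leNgt; apply/negP => wq.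
  by apply: h; exists q.
have vq : v != q by apply: contraNneq vNI => ->.
have wq1 : w q != 1.
  by apply: contraNneq vq => wq1; rewrite (@weight1_eq _ _ I q v w).
have splitE (f : d.-tuple R -> R) :
    \sum_(p <- I) f p = f q + \sum_(p <- (I `\ q)%fset) f p.
  by rewrite (big_fsetD1 q).
have wqE : \sum_(p <- (I `\ q)%fset) w p = 1 - w q.
  by rewrite -w1 splitE addrC addKr.
have nz : 1 - w q != 0 by rewrite subr_eq0 eq_sym.
have wp : 0 < 1 - w q.
  rewrite lt_def nz -wqE big_seq sumr_ge0 // => p.
  by rewrite in_fsetD1 => /andP[_] /w0.
pose z := [tuple (tnth v i - w q * tnth q i) / (1 - w q) | i < d].
have zS : conv_hull S z.
  apply: (@conv_hull_mono _ _ _ (I `\ q)%fset).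
    exact: fsubset_trans (fsubD1set _ _) IS.
  exists (fun p => w p / (1 - w q)); split => [p|  |i].
  - by rewrite in_fsetD1 => /andP[_] /w0 ?; rewrite divr_ge0 // ltW.
  - by rewrite -mulr_suml wqE divff.
  - under eq_bigr do rewrite mulrAC.
    by rewrite -mulr_suml tnth_mktuple wv splitE addrC addKr.
have qS : conv_hull S q by apply: mem_conv_hull; exact: (fsubsetP IS).
have vE i : tnth v i = w q * tnth q i + (1 - w q) * tnth z i.
  by rewrite tnth_mktuple; field.
have qz : q = z by apply: (ext q z (w q)) => //; lra.
move: vq; rewrite (_ : v = q) ?eqxx //; apply: eq_from_tnth => i.
by rewrite vE -qz; ring.
Qed.

(** * Random two-colouring of a finite list *)

Definition miss {T : Type} (A : set T) (s : seq T) : bool :=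
  all (fun p => ~~ `[< A p >]) s.

Lemma missU {T : Type} (A B : set T) (s : seq T) :
  miss (A `|` B) s = miss A s && miss B s.
Proof.
by rewrite /miss -all_predI; apply: eq_all => p /=; rewrite asbool_or negb_or.
Qed.

(* The expectation of f (I, J) when each entry of s is put into I with
   probability x and into J with probability 1 - x, independently. *)
Fixpoint thin {R : realType} {T : Type} (x : R) (s : seq T)
    (f : seq T -> seq T -> R) : R :=
  if s is p :: s' then
    x * thin x s' (fun I J => f (p :: I) J) +
    (1 - x) * thin x s' (fun I J => f I (p :: J))
  else f [::] [::].

(** Lets facts about splittings of [s], such as disjointness of the two classes when [s] has no
    duplicates, enter when the integrand is rewritten. *)
Lemma eq_thin {R : realType} {T : eqType} (x : R) (s : seq T)
    (f g : seq T -> seq T -> R) :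
  (forall I J, perm_eq (I ++ J) s -> f I J = g I J) -> thin x s f = thin x s g.
Proof.
elim: s f g => [|p s IH] f g fg /=; first exact: fg.
congr (_ * _ + _ * _); apply: IH => I J IJ; apply: fg.
  by rewrite /= perm_cons.
by rewrite -[p :: J]cat1s perm_catCA /= perm_cons.
Qed.

Lemma thinZ {R : realType} {T : Type} (x a : R) (s : seq T) f :
  thin x s (fun I J => a * f I J) = a * thin x s f.
Proof. by elim: s f => [|p s IH] f //=; rewrite !IH; ring. Qed.

Lemma thin_lin {R : realType} {T : Type} (x : R) (s : seq T) f g h :
  thin x s (fun I J => f I J + g I J - h I J) =
  thin x s f + thin x s g - thin x s h.
Proof. by elim: s f g h => [|p s IH] f g h //=; rewrite !IH; ring. Qed.

Lemma thin01 {R : realType} {T : Type} (x : R) (s : seq T) f :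
  0 <= x <= 1 -> (forall I J, 0 <= f I J <= 1) -> 0 <= thin x s f <= 1.
Proof.
move=> x01; elim: s f => [|p s IH] f f01 //=.
have := IH (fun I J => f (p :: I) J) ltac:(by []).
have := IH (fun I J => f I (p :: J)) ltac:(by []).
move: (thin _ _ _) (thin _ _ _) x01 => a b /andP[x0 x1] /andP[a0 a1] /andP[b0 b1].
by apply/andP; split; nra.
Qed.

Lemma cvg_thin {R : realType} {T : Type} (x : R) (s : seq T)
    (f : nat -> seq T -> seq T -> R) (g : seq T -> seq T -> R) :
  (forall I J, f n I J @[n --> \oo] --> g I J) ->
  thin x s (f n) @[n --> \oo] --> thin x s g.
Proof.
elim: s f g => [|p s IH] f g fg /=; first exact: fg.
by apply: cvgD; apply: cvgM; (try exact: cvg_cst); apply: IH => I J; exact: fg.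
Qed.

(** The event constrains each entry separately, so its probability factorises over the independent
    colours. *)
Lemma thin_miss {R : realType} {T : Type} (x : R) (s : seq T) (A B : set T) :
  thin x s (fun I J => (miss A I && miss B J)%:R) =
  \prod_(p <- s) (x * (~~ `[< A p >])%:R + (1 - x) * (~~ `[< B p >])%:R).
Proof.
elim: s => [|p s IH]; first by rewrite big_nil.
rewrite big_cons -IH /= [RHS]mulrDl.
congr (_ + _); rewrite -[RHS]mulrA; congr (_ * _); rewrite -thinZ; congr thin;
  apply/funext => I; apply/funext => J; rewrite -natrM mulnb.
  by rewrite andbA.
by rewrite andbCA.
Qed.

(** [A] and [B] are accumulators for the inclusion-exclusion over [l]; both start out empty. *)
Definition dominates {T : Type} (H : nat -> set T) (A B : set T)
    (l : seq nat) (I J : seq T) : bool :=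
  [&& miss A I, miss B J & all (fun k => ~~ miss (H k) I || miss (H k) J) l].

(** The indicator of the implication for [k] is the indicator of both missing, plus 1, minus that of
    [I] missing. Missing [H k] in addition to [A] is missing their union, so every term has the same
    form with a shorter list. *)
Lemma dominates_cons {R : realType} {T : Type} (H : nat -> set T) (A B : set T)
    k (l : seq nat) (I J : seq T) :
  (dominates H A B (k :: l) I J)%:R =
  (dominates H (A `|` H k) (B `|` H k) l I J)%:R +
  (dominates H A B l I J)%:R - (dominates H (A `|` H k) B l I J)%:R :> R.
Proof.
rewrite /dominates !missU /=.
by case: (miss A I); case: (miss B J); case: (miss _ I); case: (miss _ J);
  case: (all _ _); rewrite /= ?addr0 ?subr0 ?subrr ?addrK ?add0r ?subrr.
Qed.

Lemma count_inE {R : realType} {d : nat} (S : {fset d.-tuple R}) A :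
  count_in S A = count (fun p => `[< A p >]) S.
Proof.
rewrite /count_in -size_filter; apply/perm_size/uniq_perm.
- exact: fset_uniq.
- exact/filter_uniq/fset_uniq.
- by move=> p; rewrite mem_filter !inE andbC.
Qed.

Lemma miss_count_in {R : realType} {d : nat} (S : {fset d.-tuple R}) A :
  miss A S = (count_in S A == 0%N).
Proof. by rewrite count_inE eqn0Ngt -has_count -all_predC. Qed.

(** A point of [B] only must go to [I], a point of [A] only to [J], and a point of both makes the
    event impossible. The last factor relies on [0 ^+ 0 = 1]. *)
Lemma thin_miss_count_in {R : realType} {d : nat} (x : R)
    (S : {fset d.-tuple R}) (A B : set (d.-tuple R)) :
  thin x S (fun I J => (miss A I && miss B J)%:R) =
  x ^+ count_in S (B `\` A) * (1 - x) ^+ count_in S (A `\` B) *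
  0 ^+ count_in S (A `&` B).
Proof.
rewrite thin_miss !count_inE; elim: (S : seq _) => [|p s IH].
  by rewrite big_nil !expr0 !mulr1.
rewrite big_cons IH /= !asbool_and !asbool_neg.
case: (`[< A p >]); case: (`[< B p >]) => /=; rewrite ?add0n ?exprS; ring.
Qed.

Lemma thin_conv_hull {R : realType} {d : nat} (x : R) (S : {fset d.-tuple R}) :
  thin x S (fun I J =>
    `[< forall p, p \in J -> conv_hull [fset q in I]%fset p >]%:R) =
  x ^+ num_vertices S.
Proof.
(* Missing [set0] is a vacuous condition on [I], inserted so that [thin_miss_count_in] applies and
   leaves only the power of [x]. *)
rewrite (@eq_thin _ _ x S _
    (fun I J => (miss set0 I && miss [set` vertices S] J)%:R)); last first.
  move=> I J IJ; congr (nat_of_bool _)%:R.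
  have -> /= : miss set0 I by apply/allP => p _; apply/asboolP.
  have IS : ([fset q in I] `<=` S)%fset.
    by apply/fsubsetP => q; rewrite !inE -(perm_mem IJ) mem_cat => ->.
  have uIJ : uniq (I ++ J) by rewrite (perm_uniq IJ) fset_uniq.
  apply/asboolP/allP => [JI p pJ|missJ].
    (* A vertex in [J] would lie in the hull of [I], hence in [I] by extremality, although the two
       classes are disjoint. *)
    apply/asboolP => /=; rewrite !inE /= => /andP[_ /asboolP pext].
    have := extreme_point_conv_hull _ _ _ IS pext (JI p pJ).
    rewrite inE => pI; move: uIJ; rewrite cat_uniq => /and3P[_ /hasPn + _].
    by move=> /(_ p pJ); rewrite pI.
  (* Conversely, if [J] has no vertex then [I] has them all, and the vertices already span the hull
     of [S]. *)
  move=> p pJ; apply: (@conv_hull_mono _ _ _ (vertices S)).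
    apply/fsubsetP => q qV; rewrite !inE.
    have : q \in I ++ J.
      by rewrite (perm_mem IJ); move: qV; rewrite !inE => /andP[].
    rewrite mem_cat => /orP[//|/missJ]; by move=> /= /asboolP.
  rewrite conv_hull_vertices; apply: mem_conv_hull.
  by rewrite -(perm_mem IJ) mem_cat pJ orbT.
rewrite thin_miss_count_in setD0 set0D set0I.
have count0 : count_in S set0 = 0%N.
  by rewrite count_inE; apply/eqP; rewrite eqn0Ngt -has_count; apply/hasPn => p _;
    apply/asboolP.
rewrite count0 !expr0 !mulr1; congr (_ ^+ _).
rewrite /num_vertices /count_in; congr (#|` _|)%fset.
apply/fsetP => p; rewrite !inE /=; case: (boolP (p \in S)) => //= pS.
by rewrite asboolb !inE /= pS.
Qed.

(** * Approximation of the hull by finitely many half-spaces *)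

Definition missed_union {T : Type} (H : nat -> set T) (l : seq nat) (I : seq T)
    : set T :=
  \bigcup_(k in [set k | k \in l /\ miss (H k) I]) H k.

Lemma missed_union_cons {T : Type} (H : nat -> set T) k (l : seq nat)
    (I : seq T) :
  missed_union H (k :: l) I =
  (if miss (H k) I then H k else set0) `|` missed_union H l I.
Proof.
apply/seteqP; split => p.
  move=> [j [/= + mj] pj]; rewrite in_cons => /predU1P[jk|jl].
    by left; move: mj pj; rewrite jk => ->.
  by right; exists j.
case=> [|[j [/= jl mj] pj]]; last by exists j => //; rewrite /= in_cons jl orbT.
by case: ifPn => // mk pk; exists k => //=; rewrite mem_head.
Qed.

Lemma measurable_missed_union {dT : measure_display} {T : measurableType dT}
    (H : nat -> set T) (l : seq nat) (I : seq T) :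
  (forall k, measurable (H k)) -> measurable (missed_union H l I).
Proof. by move=> mH; apply: bigcup_measurable => k _; exact: mH. Qed.

Lemma missP {T : eqType} (A : set T) (s : seq T) :
  reflect (forall p, p \in s -> ~ A p) (miss A s).
Proof.
by apply: (iffP allP) => sA p /sA; [move/asboolP|move=> ?; exact/asboolP].
Qed.

(** The sequence is eventually constant: an index [k] violating the implication enters [iota 0 n]
    once [n > k], and without such an index every term is 1. *)
Lemma cvg_dominates {R : realType} {T : Type} (H : nat -> set T)
    (I J : seq T) :
  ((dominates H set0 set0 (iota 0 n) I J)%:R : R) @[n --> \oo] -->
  (`[< forall k, miss (H k) I -> miss (H k) J >]%:R : R).
Proof.
have m0 s : miss (@set0 T) s by elim: s => //= p s ->; rewrite asboolF.
rewrite /dominates !m0 /=.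
have [hH|/existsNP[k hk]] := pselect (forall k, miss (H k) I -> miss (H k) J).
  rewrite asboolT //; under eq_fun => n.
    rewrite (_ : all _ _ = true); last first.
      by apply/allP => k _; rewrite -implybE; apply/implyP; exact: hH.
    over.
  exact: cvg_cst.
rewrite asboolF; last by move/(_ k).
apply: cvg_near_cst; exists k.+1 => // n /= kn.
rewrite (_ : all _ _ = false) //; apply/negbTE/allPn; exists k.
  by rewrite mem_iota.
by rewrite -implybE; apply/negP => /implyP.
Qed.

Lemma miss_half_space_enumP {R : realType} {d : nat} (I J : seq (d.-tuple R)) :
  (forall k, miss (half_space_enum k) I -> miss (half_space_enum k) J) <->
  (forall p, p \in J -> conv_hull [fset q in I]%fset p).
Proof.
have mE k : miss (half_space_enum k) I <->
    forall q, q \in [fset q in I]%fset -> ~ half_space_enum k q.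
  split=> [/missP h q|h]; first by rewrite inE => /h.
  by apply/missP => q qI; apply: h; rewrite inE.
split=> [h p pJ|h k /mE mI].
  apply: contrapT => np.
  have : (~` conv_hull [fset q in I]%fset) p by [].
  rewrite setC_conv_hull => -[k /= /mE /h /missP /(_ p pJ)].
  by [].
apply/missP => p /h pI pk.
have : (~` conv_hull [fset q in I]%fset) p by rewrite setC_conv_hull; exists k.
by [].
Qed.

(** Continuity of [mu] from below: the finite unions increase to the complement of the hull, which
    is measurable for the same reason. *)
Lemma cvg_missed_union {R : realType} {d : nat}
    (mu : probability (d.-tuple R) R) (S : {fset d.-tuple R}) :
  fine (mu (missed_union half_space_enum (iota 0 n) S)) @[n --> \oo] -->
  fine (mu (~` conv_hull S)).
Proof.
pose F n := missed_union (@half_space_enum R d) (iota 0 n) S.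
have mF n : measurable (F n).
  by apply: measurable_missed_union => k; exact: measurable_half_space_enum.
have FE : \bigcup_n F n = ~` conv_hull S.
  rewrite setC_conv_hull; apply/seteqP; split => p.
    by move=> [n _ [k [_ /missP mk] pk]]; exists k.
  move=> [k /= mk pk]; exists k.+1 => //; exists k => //; split.
    by rewrite mem_iota add0n ltnSn.
  exact/missP.
apply: fine_cvg; rewrite fineK ?fin_num_measure //; last first.
  by rewrite -FE; exact: bigcupT_measurable.
rewrite -FE; apply: nondecreasing_cvg_mu => //; first exact: bigcupT_measurable.
move=> m n mn; apply/subsetPset => p [k [/= km mk] pk]; exists k => //=.
by split=> //; move: km; rewrite !mem_iota /= => /leq_trans; apply.
Qed.

(** * Generating functions of Poisson counts *)

Lemma measurable_fun_nat {R : realType} {dO : measure_display}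
    {Omega : measurableType dO} (N : Omega -> nat) (f : nat -> R) :
  (forall k, measurable [set w | N w = k]) ->
  measurable_fun setT (fun w => f (N w)).
Proof.
move=> mN _ Y _; rewrite setTI.
rewrite (_ : _ @^-1` Y = \bigcup_(k in [set k | Y (f k)]) [set w | N w = k]).
  by apply: bigcup_measurable => k _; exact: mN.
apply/seteqP; split => w /=; first by move=> Yw; exists (N w).
by move=> [k /= Yk ->].
Qed.

(** Cuts [D] along the level sets of [N]. A general [D] allows repeated use inside a level set, once
    for each of several counts. *)
Lemma integral_nat_split {R : realType} {dO : measure_display}
    {Omega : measurableType dO} (P : probability Omega R) (D : set Omega)
    (N : Omega -> nat) (f : nat -> R) (g : Omega -> R) :
  measurable D -> (forall k, measurable [set w | N w = k]) ->
  (forall k, 0 <= f k) -> measurable_fun setT g -> (forall w, 0 <= g w) ->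
  (\int[P]_(w in D) (f (N w) * g w)%:E =
   \sum_(k <oo) ((f k)%:E * \int[P]_(w in D `&` [set w | N w = k]) (g w)%:E))%E.
Proof.
move=> mD mN f0 mg g0.
have DE : D = \bigcup_k (D `&` [set w | N w = k]).
  by rewrite -setI_bigcupr (_ : \bigcup__ _ = setT) ?setIT //;
    apply/seteqP; split => // w _; exists (N w).
have mDN k : measurable (D `&` [set w | N w = k]) by exact: measurableI.
rewrite {1}DE ge0_integral_bigcup //.
- apply: eq_eseriesr => k _; rewrite -ge0_integralZl_EFin //.
  + by apply: eq_integral => w /set_mem[_ /= ->]; rewrite EFinM.
  + by move=> w _; rewrite lee_fin.
  + exact/measurable_EFinP/measurable_funTS.
- apply/measurable_EFinP/measurable_funTS/measurable_funM => //.
  exact: measurable_fun_nat.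
- by move=> w _; rewrite lee_fin mulr_ge0.
- apply/trivIsetP => i j _ _ ij; rewrite -subset0 => w /= [[_ wi] [_ wj]].
  by move: ij; rewrite -wi -wj eqxx.
Qed.

Lemma poisson_mass_ge0 {R : realType} (lambda : R) k :
  0 <= lambda -> 0 <= poisson_mass lambda k.
Proof. by move=> l0; rewrite !mulr_ge0 ?expR_ge0 ?exprn_ge0 ?invr_ge0. Qed.

Lemma poisson_mass_pgf {R : realType} (lambda a : R) :
  0 <= lambda -> 0 <= a ->
  (\sum_(k <oo) (a ^+ k * poisson_mass lambda k)%:E =
   (expR (- (lambda * (1 - a))))%:E)%E.
Proof.
move=> l0 a0.
have -> : - (lambda * (1 - a)) = - lambda + a * lambda by ring.
rewrite expRD EFinM.
under eq_eseriesr => k _.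
  rewrite (_ : _ * _ = expR (- lambda) * ((k`!%:R)^-1 * (a * lambda) ^+ k));
    last by rewrite /poisson_mass exprMn; ring.
  rewrite EFinM; over.
rewrite nneseriesZl; last first.
  by move=> n _; rewrite lee_fin mulr_ge0 ?invr_ge0 // exprn_ge0 // mulr_ge0.
congr *%E; rewrite expRE -EFin_lim; last first.
  rewrite /pseries /=; under eq_fun do rewrite mulrC.
  exact: is_cvg_series_exp_coeff.
by apply/congr_lim/funext => n /=; rewrite /pseries /= /series /= -sumEFin.
Qed.

Lemma poisson_counts3 {R : realType} {d : nat} {dO : measure_display}
    {Omega : measurableType dO} (P : probability Omega R)
    (mu : set (d.-tuple R) -> \bar R) (s : R) (eta : Omega -> {fset d.-tuple R})
    (X Y Z : set (d.-tuple R)) (i j k : nat) :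
  poisson_point_process P mu s eta ->
  measurable X -> measurable Y -> measurable Z ->
  X `&` Y = set0 -> X `&` Z = set0 -> Y `&` Z = set0 ->
  P ([set w | count_in (eta w) X = i] `&` [set w | count_in (eta w) Y = j] `&`
     [set w | count_in (eta w) Z = k]) =
  (poisson_mass (s * fine (mu X)) i * poisson_mass (s * fine (mu Y)) j *
   poisson_mass (s * fine (mu Z)) k)%:E.
Proof.
move=> [mE pE iE] mX mY mZ XY XZ YZ.
pose A (n : 'I_3) := nth set0 [:: X; Y; Z] n.
pose B (n : 'I_3) := [set nth 0%N [:: i; j; k] n].
have mA n : measurable (A n) by case: n => [[|[|[|?]]] ?].
have dA n m : n != m -> A n `&` A m = set0.
  by case: n m => [[|[|[|?]]] ?] [[|[|[|?]]] ?] //= _; rewrite /A /= // setIC.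
have := iE 3%N A mA dA B; rewrite !big_ord_recl big_ord0 mule1 /A /B /=.
rewrite !pE // -!EFinM mulrA => <-; congr (P _).
apply/seteqP; split => w /=.
  by move=> [[wX wY] wZ] [[|[|[|?]]] ?].
move=> h; split; first split.
- exact: (h (@Ordinal 3 0 isT)).
- exact: (h (@Ordinal 3 1 isT)).
- exact: (h (@Ordinal 3 2 isT)).
Qed.

(** Three sets are what a pair [A], [B] requires: the two differences and the intersection, the
    points outside both having thinning factor 1. *)
Lemma poisson_pgf3 {R : realType} {d : nat} {dO : measure_display}
    {Omega : measurableType dO} (P : probability Omega R)
    (mu : probability (d.-tuple R) R) (s : R) (eta : Omega -> {fset d.-tuple R})
    (X Y Z : set (d.-tuple R)) (a b c : R) :
  poisson_point_process P mu s eta -> 0 <= s ->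
  measurable X -> measurable Y -> measurable Z ->
  X `&` Y = set0 -> X `&` Z = set0 -> Y `&` Z = set0 ->
  0 <= a -> 0 <= b -> 0 <= c ->
  (\int[P]_w (a ^+ count_in (eta w) X *
       (b ^+ count_in (eta w) Y * c ^+ count_in (eta w) Z))%:E =
   (expR (- (s * (fine (mu X) * (1 - a) + fine (mu Y) * (1 - b) +
                  fine (mu Z) * (1 - c)))))%:E)%E.
Proof.
move=> ppp s0 mX mY mZ XY XZ YZ a0 b0 c0; have [mE _ _] := ppp.
have mpow A q : measurable A -> measurable_fun setT
    (fun w => q ^+ count_in (eta w) A : R).
  by move=> mA; apply: (measurable_fun_nat _ (fun n => q ^+ n)) => k; exact: mE.
have smu0 A : 0 <= s * fine (mu A) by rewrite mulr_ge0 // fine_ge0.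
pose p A := poisson_mass (s * fine (mu A)).
have p0 A k : 0 <= p A k by exact: poisson_mass_ge0.
have intZ D : measurable D ->
    (\int[P]_(w in D) (c ^+ count_in (eta w) Z)%:E = \sum_(k <oo)
      ((c ^+ k)%:E * P (D `&` [set w | count_in (eta w) Z = k])))%E.
  move=> mD; under eq_integral do rewrite -[_ ^+ _]mulr1.
  rewrite (integral_nat_split _ _ _ (fun k => c ^+ k) (cst 1)) //.
  - apply: eq_eseriesr => k _; congr *%E; rewrite -[RHS]mul1e -integral_cst //.
    by apply: measurableI => //; exact: mE.
  - by move=> k; exact: mE.
  - by move=> k; exact: exprn_ge0.
pose e A q := expR (- (s * fine (mu A) * (1 - q))).
have pgf (A : set (d.-tuple R)) q r : 0 <= q -> 0 <= r ->
    (\sum_(k <oo) ((q ^+ k)%:E * (r * p A k)%:E) = (r * e A q)%:E)%E.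
  move=> q0 r0; rewrite EFinM -poisson_mass_pgf // -nneseriesZl; last first.
    by move=> k _; rewrite lee_fin mulr_ge0 ?exprn_ge0 ?poisson_mass_ge0.
  by apply: eq_eseriesr => k _; rewrite -!EFinM mulrCA.
rewrite (integral_nat_split _ _ _ (fun k => a ^+ k)
  (fun w => b ^+ count_in (eta w) Y * c ^+ count_in (eta w) Z)) //; first last.
- by move=> w; rewrite mulr_ge0 ?exprn_ge0.
- by apply: measurable_funM; exact: mpow.
- by move=> k; exact: exprn_ge0.
- by move=> k; exact: mE.
(* The right-hand side is expanded into a series one factor at a time, to match the left-hand side
   term by term as each count is fixed. *)
transitivity (\sum_(i <oo) ((a ^+ i)%:E *
    (e Y b * e Z c * p X i)%:E))%E; last first.
  rewrite pgf ?mulr_ge0 ?expR_ge0 // /e -!expRD; congr (expR _)%:E; ring.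
apply: eq_eseriesr => i _; congr *%E.
rewrite (integral_nat_split _ _ _ (fun k => b ^+ k)
  (fun w => c ^+ count_in (eta w) Z)) //; first last.
- by move=> w; exact: exprn_ge0.
- exact: mpow.
- by move=> k; exact: exprn_ge0.
- by move=> k; exact: mE.
- by apply: measurableI => //; exact: mE.
rewrite (_ : e Y b * e Z c * p X i = p X i * e Z c * e Y b); last by ring.
rewrite -pgf ?(mulr_ge0 (p0 _ _)) ?expR_ge0 //.
apply: eq_eseriesr => j _; congr *%E.
rewrite intZ; last by do 2?apply: measurableI => //; exact: mE.
rewrite (_ : p X i * e Z c * p Y j = p X i * p Y j * e Z c); last by ring.
rewrite -pgf ?(mulr_ge0 (p0 _ _)) ?p0 //.
apply: eq_eseriesr => k _; congr *%E.
by rewrite setTI (poisson_counts3 _ _ _ _ _ _ _ _ _ _ ppp).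
Qed.

(** * Bounded integrands and the identity for finitely many half-spaces *)

Lemma integrable01 {R : realType} {dO : measure_display}
    {Omega : measurableType dO} (P : probability Omega R) (f : Omega -> R) :
  measurable_fun setT f -> (forall w, 0 <= f w <= 1) ->
  P.-integrable setT (EFin \o f).
Proof.
move=> mf f01; apply: measurable_bounded_integrable => //.
  by rewrite (@le_lt_trans _ _ 1%E) ?probability_le1 ?ltry.
exists 1; split; first exact: num_real.
move=> x x1 w _ /=; have /andP[f0 f1] := f01 w.
by rewrite ger0_norm // (le_trans f1) // ltW.
Qed.

(** Dominated convergence with bound 1. Measurability of [g] is deduced from that of the [f n]; this
    is how the vertex number and the mass outside the hull become admissible integrands. *)
Lemma cvg_integral01 {R : realType} {dO : measure_display}
    {Omega : measurableType dO} (P : probability Omega R)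
    (f : nat -> Omega -> R) (g : Omega -> R) :
  (forall n, measurable_fun setT (f n)) -> (forall n w, 0 <= f n w <= 1) ->
  (forall w, f n w @[n --> \oo] --> g w) ->
  (\int[P]_w (f n w)%:E @[n --> \oo] --> \int[P]_w (g w)%:E)%E.
Proof.
move=> mf f01 fg.
have mg : measurable_fun setT g.
  by apply: (measurable_fun_cvg mf) => w _; exact: fg.
have [] // := @dominated_convergence _ _ _ P setT measurableT
  (fun n => EFin \o f n) (EFin \o g) (cst 1%E).
- by move=> n; exact/measurable_EFinP.
- exact/measurable_EFinP.
- by apply: aeW => w _; apply: cvg_EFin; [exact: nearW|exact: fg].
- by apply: (integrable01 P (cst 1)) => // w; rewrite /= ler01 lexx.
- apply: aeW => w n _ /=; have /andP[f0 f1] := f01 n w.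
  by rewrite lee_fin ger0_norm.
Qed.

(** The thinning theorem at the level of void probabilities: the value is the product of those of
    independent Poisson processes of intensities [x * t] and [(1 - x) * t] times [mu]. It comes from
    [poisson_pgf3] with parameters [x], [1 - x] and 0. *)
Lemma integral_thin_miss {R : realType} {d : nat}
    (mu : probability (d.-tuple R) R) (t x : R) {dO : measure_display}
    {Omega : measurableType dO} (P : probability Omega R)
    (eta : Omega -> {fset d.-tuple R}) (A B : set (d.-tuple R)) :
  0 <= t -> 0 <= x <= 1 -> poisson_point_process P mu t eta ->
  measurable A -> measurable B ->
  (\int[P]_w (thin x (eta w) (fun I J => (miss A I && miss B J)%:R))%:E =
   (expR (- (t * (x * fine (mu A) + (1 - x) * fine (mu B)))))%:E)%E.
Proof.
move=> t0 /andP[x0 x1] ppp mA mB.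
have fin C : measurable C -> mu C \is a fin_num.
  by move=> mC; rewrite fin_num_measure.
have mAB : measurable (A `&` B) by exact: measurableI.
have muD C D : measurable C -> measurable D ->
    fine (mu (C `\` D)) = fine (mu C) - fine (mu (C `&` D)).
  move=> mC mD; rewrite measureD // ?fineB ?fin //; first exact: measurableI.
  by rewrite ltey_eq fin.
under eq_integral do rewrite thin_miss_count_in -mulrA.
rewrite (poisson_pgf3 P mu t) // ?subr_ge0 //; do 2?exact: measurableD.
- congr (expR (- (t * _)))%:E; rewrite !muD // (setIC B A); ring.
- by apply/seteqP; split => p // [[? ?] [? ?]].
- by apply/seteqP; split => p // [[? ?] [? ?]].
- by apply/seteqP; split => p // [[? ?] [? ?]].
Qed.

(** The conditional probability of [dominates] given [I], when [J] is an independent Poisson process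
    of intensity [c] times [mu]. *)
Definition void_weight {R : realType} {T : Type} (c : R)
    (mu : set T -> \bar R) (H : nat -> set T) (A B : set T) (l : seq nat)
    (I : seq T) : R :=
  (miss A I)%:R * expR (- (c * fine (mu (B `|` missed_union H l I)))).

(** The recursion of [dominates_cons] again. If [I] misses [H k] the last two terms cancel;
    otherwise the first and the third vanish. *)
Lemma void_weight_cons {R : realType} {T : Type} (c : R)
    (mu : set T -> \bar R) (H : nat -> set T) (A B : set T) k (l : seq nat)
    (I : seq T) :
  void_weight c mu H A B (k :: l) I =
  void_weight c mu H (A `|` H k) (B `|` H k) l I + void_weight c mu H A B l I
  - void_weight c mu H (A `|` H k) B l I.
Proof.
rewrite /void_weight missed_union_cons missU.
by case: ifP => _; rewrite ?andbT ?andbF ?mul0r ?set0U ?setUA; ring.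
Qed.

Lemma void_weight01 {R : realType} {dT : measure_display}
    {T : measurableType dT} (c : R) (mu : probability T R) (H : nat -> set T)
    (A B : set T) (l : seq nat) (I : seq T) : 0 <= c ->
  0 <= void_weight c mu H A B l I <= 1.
Proof.
move=> c0; rewrite /void_weight mulr_ge0 ?expR_ge0 //= mulr_ile1 ?expR_ge0 //.
  by case: miss.
by rewrite -expR0 ler_expR oppr_le0 mulr_ge0 // fine_ge0.
Qed.

(** Only counts are known to be measurable; the recursion on [l] reduces the integrand to powers
    with counts as exponents. *)
Lemma measurable_thin_dominates {R : realType} {d : nat}
    (mu : set (d.-tuple R) -> \bar R) (s x : R) {dO : measure_display}
    {Omega : measurableType dO} (P : probability Omega R)
    (eta : Omega -> {fset d.-tuple R}) (H : nat -> set (d.-tuple R))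
    (A B : set (d.-tuple R)) (l : seq nat) :
  poisson_point_process P mu s eta -> (forall k, measurable (H k)) ->
  measurable A -> measurable B ->
  measurable_fun setT
    (fun w => thin x (eta w) (fun I J => (dominates H A B l I J)%:R)).
Proof.
move=> [mE _ _] mH; elim: l A B => [|k l IH] A B mA mB.
  rewrite /dominates /=; under eq_fun => w.
    under eq_thin do rewrite andbT.
    rewrite thin_miss_count_in; over.
  have mpow C q : measurable C -> measurable_fun setT
      (fun w => q ^+ count_in (eta w) C : R).
    by move=> mC; apply: (measurable_fun_nat _ (fun n => q ^+ n)) => k; exact: mE.
  apply: measurable_funM; [apply: measurable_funM|]; apply: mpow;
    by [exact: measurableD|exact: measurableI].
under eq_fun => w.
  under eq_thin do rewrite dominates_cons.
  rewrite thin_lin; over.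
apply: measurable_funB; [apply: measurable_funD|];
  by apply: IH => //; exact: measurableU.
Qed.

Lemma measurable_void_weight {R : realType} {d : nat}
    (mu nu : set (d.-tuple R) -> \bar R) (s c : R) {dO : measure_display}
    {Omega : measurableType dO} (P : probability Omega R)
    (eta : Omega -> {fset d.-tuple R}) (H : nat -> set (d.-tuple R))
    (A B : set (d.-tuple R)) (l : seq nat) :
  poisson_point_process P mu s eta -> (forall k, measurable (H k)) ->
  measurable A -> measurable B ->
  measurable_fun setT (fun w => void_weight c nu H A B l (eta w)).
Proof.
move=> [mE _ _] mH; elim: l A B => [|k l IH] A B mA mB.
  apply: measurable_funM.
    under eq_fun do rewrite miss_count_in.
    by apply: (measurable_fun_nat _ (fun n => (n == 0%N)%:R)) => k; exact: mE.
  rewrite (_ : (fun w => _) = cst (expR (- (c * fine (nu B))))) //.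
  apply/funext => w /=; rewrite /missed_union bigcup0 ?setU0 //.
  by move=> k [].
under eq_fun do rewrite void_weight_cons.
apply: measurable_funB; [apply: measurable_funD|];
  by apply: IH => //; exact: measurableU.
Qed.

(** Both sides satisfy the same recursion in [l], so only the empty list needs probability. There
    the second process stands in for the colour class [I]. *)
Lemma integral_thin_dominates {R : realType} {d : nat}
    (mu : probability (d.-tuple R) R) (t x : R)
    {d1 : measure_display} {Omega1 : measurableType d1}
    (P1 : probability Omega1 R) (eta1 : Omega1 -> {fset d.-tuple R})
    {d2 : measure_display} {Omega2 : measurableType d2}
    (P2 : probability Omega2 R) (eta2 : Omega2 -> {fset d.-tuple R})
    (H : nat -> set (d.-tuple R)) (A B : set (d.-tuple R)) (l : seq nat) :
  0 <= t -> 0 <= x <= 1 ->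
  poisson_point_process P1 mu t eta1 ->
  poisson_point_process P2 mu (x * t) eta2 ->
  (forall k, measurable (H k)) -> measurable A -> measurable B ->
  (\int[P1]_w (thin x (eta1 w) (fun I J => (dominates H A B l I J)%:R))%:E =
   \int[P2]_w (void_weight ((1 - x) * t) mu H A B l (eta2 w))%:E)%E.
Proof.
move=> t0 x01 ppp1 ppp2 mH.
have c0 : 0 <= (1 - x) * t by rewrite mulr_ge0 // subr_ge0; case/andP: x01.
have i1 A' B' l' : measurable A' -> measurable B' -> P1.-integrable setT
    (EFin \o (fun w => thin x (eta1 w)
      (fun I J => (dominates H A' B' l' I J)%:R))).
  move=> mA mB; apply: integrable01 => [|w].
    exact: measurable_thin_dominates ppp1 mH mA mB.
  by apply: thin01 => // I J; case: dominates; rewrite ?ler01 ?lexx.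
have i2 A' B' l' : measurable A' -> measurable B' -> P2.-integrable setT
    (EFin \o (fun w => void_weight ((1 - x) * t) mu H A' B' l' (eta2 w))).
  move=> mA mB; apply: integrable01 => [|w]; last exact: void_weight01.
  exact: measurable_void_weight ppp2 mH mA mB.
elim: l A B => [|k l IH] A B mA mB.
  transitivity (\int[P1]_w (thin x (eta1 w)
      (fun I J => (miss A I && miss B J)%:R))%:E)%E.
    apply: eq_integral => w _; congr (thin _ _ _)%:E.
    by apply/funext => I; apply/funext => J; rewrite /dominates /= andbT.
  rewrite (integral_thin_miss mu t) //.
  have [mE pE _] := ppp2.
  rewrite (_ : (fun w => _) = (fun w =>
      ((\1_[set w | count_in (eta2 w) A = 0%N] w)%:E *
       (expR (- ((1 - x) * t * fine (mu B))))%:E)%E)); last first.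
    apply/funext => w; rewrite /void_weight /missed_union bigcup0; last first.
      by move=> k [].
    rewrite setU0 EFinM miss_count_in indicE.
    congr ((nat_of_bool _)%:R%:E * _)%E.
    by apply/eqP/idP => [h|]; rewrite inE.
  rewrite integralZr //; last first.
    apply: (integrable01 P2 (\1_[set w | count_in (eta2 w) A = 0%N])).
      exact/measurable_indic/mE.
    by move=> w; rewrite indicE; case: (_ \in _); rewrite ?ler01 ?lexx.
  rewrite integral_indic ?setIT //; last exact: mE.
  transitivity ((poisson_mass (x * t * fine (mu A)) 0)%:E *
      (expR (- ((1 - x) * t * fine (mu B))))%:E)%E; last first.
    by congr (_ * _)%E; rewrite -pE.
  rewrite /poisson_mass expr0 fact0 divr1 mulr1 -EFinM -expRD.
  by congr (expR _)%:E; ring.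
have mAk := measurableU _ _ mA (mH k); have mBk := measurableU _ _ mB (mH k).
(* The recursion has a negative term, so splitting the integral needs integrability; all terms lie
   between 0 and 1. *)
transitivity (\int[P1]_w (
    (thin x (eta1 w) (fun I J =>
       (dominates H (A `|` H k) (B `|` H k) l I J)%:R))%:E +
    (thin x (eta1 w) (fun I J => (dominates H A B l I J)%:R))%:E -
    (thin x (eta1 w) (fun I J =>
       (dominates H (A `|` H k) B l I J)%:R))%:E))%E.
  apply: eq_integral => w _; apply: (congr1 EFin); rewrite -thin_lin.
  by congr (thin _ _ _); apply/funext => I; apply/funext => J;
    exact: dominates_cons.
rewrite integralB //; [|apply: integrableD => //; exact: i1|exact: i1].
rewrite integralD //; [|exact: i1|exact: i1].
rewrite !IH //.
rewrite -integralD //; [|exact: i2|exact: i2].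
rewrite -integralB //; [|apply: integrableD => //; exact: i2|exact: i2].
by apply: eq_integral => w _; rewrite void_weight_cons.
Qed.

(** * Passage to the limit over all half-spaces *)

Theorem theorem4 (R : realType) (d : nat)
    (mu : probability (d.-tuple R) R) (t : R) :
  abs_cont_lebesgue mu -> 0 < t ->
  forall x : R, 0 <= x <= 1 ->
  forall (d1 : measure_display) (Omega1 : measurableType d1)
         (P1 : probability Omega1 R) (eta1 : Omega1 -> {fset d.-tuple R}),
  poisson_point_process P1 mu t eta1 ->
  forall (d2 : measure_display) (Omega2 : measurableType d2)
         (P2 : probability Omega2 R) (eta2 : Omega2 -> {fset d.-tuple R}),
  poisson_point_process P2 mu (x * t) eta2 ->
  (\int[P1]_w (x ^+ num_vertices (eta1 w))%:E
   = \int[P2]_w (expR (t * (x - 1) * fine (mu (~` conv_hull (eta2 w)))))%:E)%E.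
Proof.
move=> _ t0 x x01 d1 Omega1 P1 eta1 ppp1 d2 Omega2 P2 eta2 ppp2.
have c0 : 0 <= (1 - x) * t.
  by apply: mulr_ge0; rewrite ?subr_ge0 ?(ltW t0) //; case/andP: x01.
pose H := @half_space_enum R d.
have mH k : measurable (H k) by exact: measurable_half_space_enum.
pose f n w := thin x (eta1 w)
  (fun I J => (dominates H set0 set0 (iota 0 n) I J)%:R : R).
pose g n w := void_weight ((1 - x) * t) mu H set0 set0 (iota 0 n) (eta2 w).
have fcvg : (\int[P1]_w (f n w)%:E @[n --> \oo] -->
    \int[P1]_w (x ^+ num_vertices (eta1 w))%:E)%E.
  apply: cvg_integral01 => [n|n w|w].
  - exact: measurable_thin_dominates ppp1 mH measurable0 measurable0.
  - by apply: thin01 => // I J; case: dominates; rewrite ?ler01 ?lexx.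
  - rewrite -thin_conv_hull; apply: cvg_thin => I J.
    (* In the limit all half-spaces are tested, and the condition becomes that [J] lies in the hull
       of [I]. *)
    rewrite -(asbool_equiv_eq (miss_half_space_enumP I J)).
    exact: cvg_dominates.
have gcvg : (\int[P2]_w (g n w)%:E @[n --> \oo] --> \int[P2]_w
    (expR (t * (x - 1) * fine (mu (~` conv_hull (eta2 w)))))%:E)%E.
  apply: cvg_integral01 => [n|n w|w].
  - exact: measurable_void_weight ppp2 mH measurable0 measurable0.
  - exact: void_weight01.
  - rewrite (_ : t * (x - 1) * _ =
      - ((1 - x) * t * fine (mu (~` conv_hull (eta2 w))))); last by ring.
    rewrite /g /void_weight.
    under eq_fun => n.
      rewrite (_ : miss set0 _ = true); last by apply/missP => p _ [].
      rewrite mul1r set0U; over.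
    apply: continuous_cvg; first exact: continuous_expR.
    by apply: cvgN; apply: cvgM; [exact: cvg_cst|exact: cvg_missed_union].
have fg n : (\int[P1]_w (f n w)%:E = \int[P2]_w (g n w)%:E)%E.
  by apply: integral_thin_dominates => //; exact: ltW.
move: fcvg; rewrite (funext fg) => fcvg.
exact: cvg_unique fcvg gcvg.
Qed.
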